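(* Let $f:[a,b]\to\mathbb{R}$ be a continuous $\Phi$-monotone function. Then for any $n\in\mathbb{N}$, $$f(a)-\frac{n}{2}\Phi\Big(\frac{b-a}{n}\Big)\leq\frac{1}{b-a}\mathcal{T}_{n}(f)\leq f(b)+\frac{n}{2}\Phi\Big(\frac{b-a}{n}\Big).$$
   Context: Let $a<b$ be real numbers. $\mathbb{N}$ denotes the set of positive integers and $\mathbb{R}_+$ the set of nonnegative reals. $\Phi:[0,b-a]\to\mathbb{R}_+$ is an arbitrary function (called the error function). A function $f:[a,b]\to\mathbb{R}$ is $\Phi$-monotone if $f(x)\leq f(y)+\Phi(y-x)$ for all $x,y\in[a,b]$ with $x<y$. For $n\in\mathbb{N}$ put $x_i=a+\frac{(b-a)i}{n}$, $i=0,1,\ldots,n$. The Trapezoidal rule is $$\mathcal{T}_{n}(f)=\frac{b-a}{2n}\Big[f(x_0)+2\sum_{i=1}^{n-1}f(x_i)+f(x_n)\Big].$$ *)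

(* Defs.v *)
From mathcomp Require Import all_boot all_order all_algebra.
From mathcomp Require Import all_classical all_reals all_analysis.

Set Implicit Arguments.
Unset Strict Implicit.
Unset Printing Implicit Defensive.

Import Order.TTheory GRing.Theory Num.Theory.
Import numFieldNormedType.Exports.

Local Open Scope ring_scope.

(* Functions on [a, b] and on [0, b - a] are represented by total functions
   R -> R; only their values on the interval are ever constrained or used. *)

Definition error_function (R : realType) (a b : R) (Phi : R -> R) : Prop :=
  forall t, t \in `[0, b - a] -> 0 <= Phi t.

Definition phi_monotone (R : realType) (a b : R) (Phi f : R -> R) : Prop :=
  forall x y, x \in `[a, b] -> y \in `[a, b] -> x < y ->
    f x <= f y + Phi (y - x).

Definition node (R : realType) (a b : R) (n i : nat) : R :=
  a + (b - a) * i%:R / n%:R.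

Definition trapezoidal (R : realType) (a b : R) (n : nat) (f : R -> R) : R :=
  (b - a) / (2 * n%:R) *
  (f (node a b n 0) + 2 * (\sum_(1 <= i < n) f (node a b n i))
   + f (node a b n n)).

(* Main.v *)
Require Import Defs.
From mathcomp Require Import all_boot all_order all_algebra.
From mathcomp Require Import all_classical all_reals all_analysis.
From mathcomp Require Import ring lra.
Import Order.TTheory GRing.Theory Num.Theory.
Import numFieldNormedType.Exports.
Local Open Scope classical_set_scope.
Local Open Scope ring_scope.

(** Put [c := Phi ((b - a) / n)]. Consecutive nodes are at distance
    [(b - a) / n], so the sequence [g i := f (node a b n i)] loses at most [c]
    at each step. Hence [g i >= g 0 - i * c] and [g i <= g n + (n - i) * c]:
    the nodal values lie above and below sequences that are affine in [i], and
    the trapezoidal mean of an affine sequence is the mean of its two end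
    values, namely [f a - n / 2 * c] and [f b + n / 2 * c].

    To carry this out, the trapezoidal sum is written panel by panel as the sum
    of [g i + g i.+1] over [i < n] ([panel_sumE]); both bounds then follow by
    induction on the number of panels ([panel_sum_ge], [panel_sum_le]), the
    squares arising as sums of consecutive odd numbers. *)

(** The two halves of every interior value come from the two panels meeting at
    that node. For [n = 0] the identity fails: the left side is [g 0 *+ 2]. *)
Lemma panel_sumE (R : pzRingType) (g : nat -> R) (n : nat) : (0 < n)%N ->
  g 0 + 2 * (\sum_(1 <= i < n) g i) + g n = \sum_(i < n) (g i + g i.+1).
Proof.
case: n => // n _; rewrite big_split /= mulr_natl mulr2n.
by rewrite big_ord_recl big_ord_recr /= big_add1 big_mkord !addrA.
Qed.

Section BoundedDescent.
Variables (R : realDomainType) (g : nat -> R) (c : R).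

Lemma descent_ge (n : nat) : (forall i, (i < n)%N -> g i <= g i.+1 + c) ->
  g 0 - n%:R * c <= g n.
Proof.
elim: n => [_|n IHn step]; first by rewrite mul0r subr0.
have := IHn (fun i lt_in => step i (ltnW lt_in)); have := step n (leqnn _).
by rewrite -natr1; lra.
Qed.

(** The new panel contributes [g n + g n.+1 >= 2 * g 0 - (2 * n + 1) * c]. *)
Lemma panel_sum_ge (n : nat) : (forall i, (i < n)%N -> g i <= g i.+1 + c) ->
  n%:R * (2 * g 0 - n%:R * c) <= \sum_(i < n) (g i + g i.+1).
Proof.
elim: n => [_|n IHn step]; first by rewrite big_ord0 mul0r.
have step_n i : (i < n)%N -> g i <= g i.+1 + c by move=> /ltnW; apply: step.
have := IHn step_n; have := descent_ge _ step_n; have := descent_ge _ step.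
by rewrite big_ord_recr /= -natr1; lra.
Qed.

(** Here the reference value [g n] moves with the induction: replacing it by
    [g n.+1] in the bound, and in the new panel, uses the last step
    [2 * n + 1] times. *)
Lemma panel_sum_le (n : nat) : (forall i, (i < n)%N -> g i <= g i.+1 + c) ->
  \sum_(i < n) (g i + g i.+1) <= n%:R * (2 * g n + n%:R * c).
Proof.
elim: n => [_|n IHn step]; first by rewrite big_ord0 mul0r.
have := IHn (fun i lt_in => step i (ltnW lt_in)).
have : (2 * n%:R + 1) * g n <= (2 * n%:R + 1) * (g n.+1 + c).
  by rewrite ler_wpM2l ?step // addr_ge0 // mulr_ge0.
by rewrite big_ord_recr /= -natr1; lra.
Qed.

End BoundedDescent.

Section Nodes.
Variables (R : realType) (a b : R) (n : nat).

Lemma node0 : node a b n 0 = a.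
Proof. by rewrite /node mulr0 mul0r addr0. Qed.

Lemma node_last : (0 < n)%N -> node a b n n = b.
Proof.
by move=> n_gt0; rewrite /node mulfK ?pnatr_eq0 -?lt0n // addrC subrK.
Qed.

Lemma node_step (i : nat) : node a b n i.+1 - node a b n i = (b - a) / n%:R.
Proof. by rewrite /node -natr1; ring. Qed.

Lemma node_itv (i : nat) : a <= b -> (0 < n)%N -> (i <= n)%N ->
  node a b n i \in `[a, b].
Proof.
move=> leab n_gt0 le_in; rewrite in_itv /= /node lerDl -lerBrDl -mulrA.
have n_pos : 0 < n%:R :> R by rewrite ltr0n.
rewrite mulr_ge0 ?subr_ge0 ?divr_ge0 //=.
by rewrite ler_piMr ?subr_ge0 // ler_pdivrMr // mul1r ler_nat.
Qed.

Lemma phi_monotone_node (Phi f : R -> R) (i : nat) :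
  a < b -> phi_monotone a b Phi f -> (i < n)%N ->
  f (node a b n i) <= f (node a b n i.+1) + Phi ((b - a) / n%:R).
Proof.
move=> ltab f_mono lt_in; have n_gt0 : (0 < n)%N by apply: leq_trans lt_in.
rewrite -(node_step i); apply: f_mono.
- by rewrite node_itv ?(ltW ltab) // ltnW.
- by rewrite node_itv ?(ltW ltab).
by rewrite -subr_gt0 node_step divr_gt0 ?subr_gt0 ?ltr0n.
Qed.

Lemma trapezoidal_meanE (f : R -> R) : a < b -> (0 < n)%N ->
  1 / (b - a) * trapezoidal a b n f =
  (\sum_(i < n) (f (node a b n i) + f (node a b n i.+1))) / (2 * n%:R).
Proof.
move=> ltab n_gt0; rewrite /trapezoidal (panel_sumE _ (f \o node a b n)) //=.
by field; rewrite pnatr_eq0 -lt0n n_gt0 subr_eq0 gt_eqF.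
Qed.

End Nodes.

Theorem theorem1 (R : realType) (a b : R) (Phi f : R -> R)
    (ltab : a < b)
    (Phi_err : error_function a b Phi)
    (f_cont : {within `[a, b], continuous f})
    (f_mono : phi_monotone a b Phi f)
    (n : nat) (n_gt0 : (0 < n)%N) :
  f a - n%:R / 2 * Phi ((b - a) / n%:R) <= 1 / (b - a) * trapezoidal a b n f
  /\ 1 / (b - a) * trapezoidal a b n f <= f b + n%:R / 2 * Phi ((b - a) / n%:R).
Proof.
have n2_gt0 : 0 < 2 * n%:R :> R by rewrite mulr_gt0 ?ltr0n.
have step i : (i < n)%N ->
    (f \o node a b n) i <= (f \o node a b n) i.+1 + Phi ((b - a) / n%:R).
  exact: phi_monotone_node.
have := panel_sum_le _ _ _ _ step; have := panel_sum_ge _ _ _ _ step.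
rewrite /= node0 node_last // trapezoidal_meanE // => lower upper.
rewrite ler_pdivlMr // ler_pdivrMr //; split; lra.
Qed.
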